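(* Let $W$ be a simply laced Weyl group. Let $v,w\in W$ be such that $\ell(v,w)=2$ and $v\leq w$. Suppose that for all $\beta\in A_\ell(v)$ we have $s_\beta v\leq w$. Then there exists $\beta\in A_\ell(v)$ such that $s_\beta w<w$.
   Context: $R$ is a simply laced root system, i.e. a reduced, irreducible, crystallographic root system whose Dynkin diagram has only simple edges (types $\mathsf A_n,\mathsf D_n,\mathsf E_6,\mathsf E_7,\mathsf E_8$); $W$ is its Weyl group (a simply laced Weyl group), $\Delta$ a fixed base of simple roots, $s_\alpha$ the reflection in a root $\alpha$. $\ell(\cdot)$ is the length function with respect to the simple reflections $s_\beta$, $\beta\in\Delta$, $\ell(v,w)=\ell(w)-\ell(v)$, and $\leq$ (strictly: $<$) is the (strong) Bruhat order on $W$. For $v\in W$, $A_\ell(v)=\{\beta\in\Delta: v<s_\beta v\}$. *)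

(* Defs.v *)
From HB Require Import structures.
From Stdlib Require Export Relation_Operators.
From mathcomp Require Export all_boot all_order all_algebra boolp.

Set Implicit Arguments.
Unset Strict Implicit.
Unset Printing Implicit Defensive.

Import GRing.Theory.
Local Open Scope ring_scope.

Section RootSystem.

(* A Euclidean space: a finite-dimensional space V over an ordered field R
   with a positive definite symmetric bilinear form f. *)
Variables (R : realFieldType) (V : vectType R) (f : {dot V for idfun}).

(* cartan b a = <b, a^\vee> *)
Definition cartan (b a : V) : R := 2 * f b a / f a a.

Definition reflect_fun (a x : V) : V := x - cartan x a *: a.

Fact reflect_fun_is_linear a : linear (reflect_fun a).
Proof.
move=> c x y; rewrite /reflect_fun /cartan linearPl /= mulrDr mulrDl scalerDl.
rewrite scalerBr scalerA opprD addrACA; congr (_ - _ *: _ + _).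
by rewrite mulrCA -!mulrA.
Qed.

HB.instance Definition _ a :=
  GRing.isLinear.Build R V V *:%R (reflect_fun a) (reflect_fun_is_linear a).

Definition refl (a : V) : 'End(V) := linfun (reflect_fun a).

Lemma reflE a x : refl a x = x - (2 * f x a / f a a) *: a.
Proof. by rewrite lfunE. Qed.

(* A finite set of vectors is given by a sequence, of which only the
   membership predicate is used. *)
Variable Phi : seq V.

Record root_system : Prop := RootSystem {
  root_neq0 : 0 \notin Phi;
  root_span : <<Phi>>%VS = fullv;
  root_refl : {in Phi &, forall a b, refl a b \in Phi};
  root_crystallographic :
    {in Phi &, forall a b, exists m : int, cartan b a = m%:~R};
  root_reduced :
    forall (c : R) a, a \in Phi -> c *: a \in Phi -> c = 1 \/ c = -1
}.

(* Phi is nonempty and is not the union of two nonempty mutually orthogonal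
   subsets. *)
Definition irreducible : Prop :=
  (exists a, a \in Phi) /\
  forall A : pred V,
    (exists2 a, a \in Phi & A a) -> (exists2 b, b \in Phi & ~~ A b) ->
    ~ {in Phi &, forall a b, A a -> ~~ A b -> f a b = 0}.

Variable Delta : seq V.

Record base : Prop := Base {
  base_sub : {subset Delta <= Phi};
  base_basis : basis_of fullv Delta;
  base_sign : {in Phi, forall a, exists c : V -> nat,
    a = \sum_(b <- Delta) b *+ c b \/ a = - (\sum_(b <- Delta) b *+ c b)}
}.

(* In the Dynkin diagram, distinct simple roots a and b are joined by
   <a, b^\vee> <b, a^\vee> edges. *)
Definition simply_laced : Prop :=
  {in Delta &, forall a b, a != b ->
    cartan a b * cartan b a = 0 \/ cartan a b * cartan b a = 1}.

Definition refl_prod (s : seq V) : 'End(V) :=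
  foldr (fun a g => (refl a \o g)%VF) \1%VF s.

(* Reflections are involutions, so the group they generate is the set of
   their products. *)
Definition weyl (w : 'End(V)) : Prop :=
  exists2 s, {subset s <= Phi} & w = refl_prod s.

Definition has_expr (w : 'End(V)) (k : nat) : Prop :=
  exists s, [/\ {subset s <= Delta}, size s = k & w = refl_prod s].

(* The least number of simple reflections with product w; the value 0 is a
   dummy when w is not such a product, which does not happen for w in the
   Weyl group when Delta is a base. *)
Definition len (w : 'End(V)) : nat :=
  if pselect (exists k, `[< has_expr w k >]) is left ex then ex_minn ex else 0.

Definition len_diff (v w : 'End(V)) : int := (len w)%:Z - (len v)%:Z.

Definition bruhat_step (u w : 'End(V)) : Prop :=
  exists2 a, a \in Phi & w = (refl a \o u)%VF /\ (len u < len w)%N.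

Definition bruhat_le : 'End(V) -> 'End(V) -> Prop :=
  clos_refl_trans _ bruhat_step.

Definition bruhat_lt (v w : 'End(V)) : Prop := bruhat_le v w /\ v <> w.

Definition left_ascent (v : 'End(V)) (b : V) : Prop :=
  b \in Delta /\ bruhat_lt v (refl b \o v)%VF.

End RootSystem.

(* Main.v *)
From HB Require Import structures.
From mathcomp Require Import ring lra.
From Stdlib Require Import Operators_Properties.
Require Import Defs.

Set Implicit Arguments.
Unset Strict Implicit.
Unset Printing Implicit Defensive.

Import Order.TTheory GRing.Theory Num.Theory.
Local Open Scope ring_scope.

(** Write $(x, y)$ for the form normalised so that all roots have norm 2; on
roots it takes the values 0, 1, -1 except at equal or opposite pairs. Lengths
enter only through the criterion [len_refl_gt]: for a positive root a, s_a w
is longer than w exactly when w^-1 a is positive.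

Let b be an ascent of v (one exists because v < w). Then w covers s_b v, so
w = s_g s_b v for a positive root g. If (b, g) is 0 or 1, a computation with
the criterion shows that b is a descent of w. If (b, g) = -1 and b is not a
descent of w, then v^-1 g is positive ([ascent_not_descent]). If v had another
ascent a that is not a descent of w, then w v^-1 would also be s_d s_a for
some d, so that a would lie in the plane of b and g, which forces a = g
([coplanar_simple]); but g is inverted by w. So, if the theorem fails, b is
the only ascent of v.

This is contradictory ([level_contradiction]). Let H x be the height of
v^-1 x, and call the coefficient of b in a root its level. Positive roots of
level 0 have H < 0, since v inverts all simple roots other than b, whereas H b
and H g are positive. Consider the linear form
  L x = H b * (x, g) + H x,
so that L b = 0 and L g = 2 * H b + H g > 0. Let k be a root of level 0 with
(b, k) = -1; it is positive, and L k < 0. This is clear when (k, g) <= 0. When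
(k, g) = 1, the roots g - k and k form a decomposition of g; if H (b + k) were
positive, s_b v would invert neither part, hence multiplication by s_g would
lengthen s_b v by at least 3 ([len_refl_add]), and not by 1; so H (b + k) < 0,
which is L k < 0. Every root of level 1 is b plus a sum of such roots k
([level_one_ind]), so L <= 0 at level 1, and every root of positive level is a
sum of roots of level 1 ([level_ind]), so L g <= 0. *)

(** * Reflections and the form *)

Section Reflections.

Variables (R : realFieldType) (V : vectType R) (f : {dot V for idfun}).

Lemma dotC x y : f x y = f y x.
Proof. by rewrite hermC /= expr0 mul1r. Qed.

Lemma dot_gt0 x : x != 0 -> 0 < f x x.
Proof. exact: neq0_dnorm_gt0. Qed.

Lemma refl_simpl a : a != 0 -> refl f a a = - a.
Proof.
move=> /dot_gt0 a0; rewrite reflE mulfK ?gt_eqF // scaler_nat mulr2n.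
by rewrite opprD addNKr.
Qed.

Lemma reflK a : involutive (refl f a).
Proof.
move=> x; have [->|a0] := eqVneq a 0; first by rewrite !reflE !scaler0 !subr0.
have fa := dot_gt0 a0.
rewrite {1}reflE [in X in X - _]reflE -addrA -opprD -scalerDl.
rewrite reflE linearBl /= linearZl_LR /=.
suff -> : 2 * f x a / f a a
    + 2 * (f x a - 2 * f x a / f a a * f a a) / f a a = 0.
  by rewrite scale0r subr0.
by field; rewrite gt_eqF.
Qed.

Lemma refl_isometry a x y : f (refl f a x) (refl f a y) = f x y.
Proof.
have [->|a0] := eqVneq a 0; first by rewrite !reflE !scaler0 !subr0.
have fa := dot_gt0 a0.
rewrite !reflE !(linearBl, linearBr, linearZl_LR, linearZr_LR) /=.
by rewrite (dotC a y); field; rewrite gt_eqF.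
Qed.

Lemma reflN a : refl f (- a) = refl f a.
Proof.
apply/lfunP => x; rewrite !reflE linearNr linearNl /= linearNr /= opprK.
by rewrite scalerN mulrN mulNr scaleNr opprK.
Qed.

Lemma refl_conj a b :
  (refl f (refl f b a) \o refl f b = refl f b \o refl f a)%VF.
Proof.
apply/lfunP => x; rewrite !comp_lfunE [in LHS]reflE !refl_isometry.
by rewrite (reflE f a x) [RHS]linearB /= [in RHS]linearZ.
Qed.

Lemma refl_refl a b x :
  refl f (refl f b a) x = refl f b (refl f a (refl f b x)).
Proof.
by have /lfunP/(_ (refl f b x)) := refl_conj a b; rewrite !comp_lfunE reflK.
Qed.

Lemma refl_cartan a x : refl f a x = x - cartan f x a *: a.
Proof. exact: reflE. Qed.

Lemma refl_fix a x : cartan f x a = 0 -> refl f a x = x.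
Proof. by move=> e; rewrite refl_cartan e scale0r subr0. Qed.

Lemma refl_sub a x : cartan f x a = 1 -> refl f a x = x - a.
Proof. by move=> e; rewrite refl_cartan e scale1r. Qed.

Lemma refl_add a x : cartan f x a = -1 -> refl f a x = x + a.
Proof. by move=> e; rewrite refl_cartan e scaleN1r opprK. Qed.

End Reflections.

(** * Positive roots *)

Section Base.

Variables (R : realFieldType) (V : vectType R) (f : {dot V for idfun}).
Variables (Phi Delta : seq V).
Hypotheses (Phi_root : root_system f Phi) (Delta_base : base Phi Delta).

Local Notation s := (refl f).

Lemma root_nz a : a \in Phi -> a != 0.
Proof. by move=> Ha; apply: contraNneq (root_neq0 Phi_root) => <-. Qed.

Lemma simple_root b : b \in Delta -> b \in Phi.
Proof. exact: base_sub. Qed.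

Lemma rootN a : a \in Phi -> - a \in Phi.
Proof.
by move=> Ha; rewrite -(refl_simpl f (root_nz Ha)); apply: (root_refl Phi_root).
Qed.

(** The linear form with prescribed values on the simple roots; positivity,
heights and coefficients of roots are all read off such forms. *)
Definition extend (phi : V -> R) (x : V) : R :=
  \sum_(i < size Delta) coord (in_tuple Delta) i x * phi Delta`_i.

Fact extend_is_scalar phi : scalar (extend phi).
Proof.
move=> k x y; rewrite /extend mulr_sumr -big_split; apply: eq_bigr => i _.
by rewrite linearP mulrDl mulrA.
Qed.

HB.instance Definition _ phi :=
  GRing.isLinear.Build R V R *%R (extend phi) (extend_is_scalar phi).

Lemma simple_free : free Delta.
Proof. exact: basis_free (base_basis Delta_base). Qed.

Lemma extendE phi b : b \in Delta -> extend phi b = phi b.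
Proof.
move=> /(nthP 0)[k Hk <-]; pose i0 := Ordinal Hk.
have cE i : coord (in_tuple Delta) i Delta`_k = (i0 == i)%:R.
  exact: (@coord_free R V _ (in_tuple Delta) i0 i simple_free).
rewrite /extend (bigD1 i0) //= cE eqxx mul1r big1 ?addr0 // => i ni.
by rewrite cE eq_sym (negbTE ni) mul0r.
Qed.

Definition height : {scalar V} := extend (fun=> 1).
Definition coef (b : V) : {scalar V} := extend (fun a => (a == b)%:R).

Lemma height_simple b : b \in Delta -> height b = 1.
Proof. exact: extendE. Qed.

Lemma coef_simple a b : a \in Delta -> coef b a = (a == b)%:R.
Proof. exact: extendE. Qed.

Lemma scalar_nat_sum (F : {scalar V}) (c : V -> nat) (r : seq V) :
  F (\sum_(b <- r) b *+ c b) = \sum_(b <- r) F b *+ c b.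
Proof. by rewrite linear_sum; apply: eq_bigr => b _; rewrite raddfMn. Qed.

Lemma coef_sum (c : V -> nat) b : b \in Delta ->
  coef b (\sum_(a <- Delta) a *+ c a) = (c b)%:R.
Proof.
move=> Hb; rewrite scalar_nat_sum (bigD1_seq b) ?free_uniq ?simple_free //=.
rewrite coef_simple // eqxx big_seq_cond big1 ?addr0 //.
move=> a /andP[Ha /negPf ne].
by rewrite coef_simple // ne mul0rn.
Qed.

Lemma height_sum (c : V -> nat) :
  height (\sum_(a <- Delta) a *+ c a) = (\sum_(a <- Delta) c a)%:R.
Proof.
rewrite scalar_nat_sum natr_sum !big_seq; apply: eq_bigr => a Ha.
by rewrite height_simple.
Qed.

Lemma pos_expand a : a \in Phi -> 0 < height a ->
  exists c : V -> nat, a = \sum_(b <- Delta) b *+ c b.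
Proof.
move=> Ha; have [c [->|->]] := base_sign Delta_base Ha; first by exists c.
by rewrite linearN /= height_sum oppr_gt0 ltNge ler0n.
Qed.

Lemma height_neq0 a : a \in Phi -> height a != 0.
Proof.
move=> Ha; have := root_nz Ha.
have [c [->|->]] := base_sign Delta_base Ha; rewrite ?linearN ?oppr_eq0 /=;
  apply: contra; rewrite height_sum pnatr_eq0 sum_nat_seq_eq0 => /allP H0;
  by rewrite big_seq big1 // => b /H0 /= /eqP->.
Qed.

(** A root is positive when its height is, so sign coherence of the base gives
a dichotomy on the sign of the height. *)
Lemma heightP a : a \in Phi -> 0 < height a \/ height a < 0.
Proof. by move/height_neq0; rewrite neq_lt => /orP[]; [right|left]. Qed.

Lemma coef_ge0 a b : a \in Phi -> 0 < height a -> b \in Delta -> 0 <= coef b a.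
Proof. by move=> Ha /(pos_expand Ha)[c ->] Hb; rewrite coef_sum. Qed.

Lemma coef_gt0_pos a b :
  a \in Phi -> b \in Delta -> 0 < coef b a -> 0 < height a.
Proof.
move=> Ha Hb; case: (heightP Ha) => // ha.
have := @coef_ge0 (- a) b (rootN Ha) _ Hb.
rewrite !linearN /= oppr_gt0 => /(_ ha).
by rewrite oppr_ge0 leNgt => /negbTE->.
Qed.

Lemma refl_linE (F : {scalar V}) a x : F (s a x) = F x - cartan f x a * F a.
Proof. by rewrite reflE linearB scalarZ. Qed.

Lemma height_bound a : a \in Phi -> exists n : nat, height a <= n%:R.
Proof.
move=> Ha; have [ha|ha] := heightP Ha; last by exists 0%N; apply: ltW.
have [c ->] := pos_expand Ha ha; exists (\sum_(d <- Delta) c d)%N.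
by rewrite height_sum.
Qed.

(** A simple reflection changes only its own coefficient, and a positive root
that is not a multiple of the simple root has another positive coefficient. *)
Lemma pos_refl a b : a \in Phi -> b \in Delta -> 0 < height a -> a <> b ->
  0 < height (s b a).
Proof.
move=> Ha Hb ha nab; have Hb' := simple_root Hb.
have Hsa : s b a \in Phi by apply: (root_refl Phi_root).
have [|hs] := heightP Hsa => //.
have [c ec] := pos_expand Ha ha.
have c0 d : d \in Delta -> d != b -> c d = 0%N.
  move=> Hd nd; have := @coef_ge0 (- s b a) d (rootN Hsa) _ Hd.
  rewrite !linearN /= oppr_gt0 => /(_ hs); rewrite refl_linE (coef_simple d Hb).
  rewrite [b == d]eq_sym (negbTE nd) mulr0 subr0 oppr_ge0 {1}ec coef_sum //.
  by rewrite lern0 => /eqP.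
have ea : a = (c b)%:R *: b.
  rewrite {1}ec (bigD1_seq b) ?free_uniq ?simple_free //= scaler_nat.
  rewrite big_seq_cond big1 ?addr0 // => d /andP[Hd nd]; by rewrite c0.
have := root_reduced Phi_root Hb'; move/(_ (c b)%:R); rewrite -ea.
case/(_ Ha) => e; move: ea; rewrite e ?scale1r // => ea.
by have := ler0n R (c b); rewrite e; lra.
Qed.

Lemma cartan_int a b :
  a \in Phi -> b \in Phi -> exists m : int, cartan f a b = m%:~R.
Proof. by move=> Ha Hb; apply: (root_crystallographic Phi_root). Qed.

Fact cartan_is_scalar a : scalar (cartan f ^~ a).
Proof. by move=> k x y; rewrite /cartan linearPl /=; ring. Qed.

Definition pairing (a x : V) : R := cartan f x a.

HB.instance Definition _ a :=
  GRing.isLinear.Build R V R *%R (pairing a) (cartan_is_scalar a).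

Lemma scalar_simple_gt0 (F : {scalar V}) (c : V -> nat) x :
  x = \sum_(b <- Delta) b *+ c b -> 0 < F x ->
  exists2 b, b \in Delta & (0 < c b)%N /\ 0 < F b.
Proof.
move=> ex hx; apply: contrapT => H; suff: F x <= 0 by rewrite leNgt hx.
rewrite ex scalar_nat_sum big_seq; apply: sumr_le0 => b Hb.
case: (posnP (c b)) => [->|cb]; first by rewrite mulr0n.
apply: mulrn_wle0; rewrite leNgt; apply/negP => Fb; apply: H; by exists b.
Qed.

Lemma cartan_diag a : a \in Phi -> cartan f a a = 2.
Proof. by move/root_nz/(dot_gt0 f) => a0; rewrite /cartan mulfK // gt_eqF. Qed.

Lemma cartan_gt0 a b : b \in Phi -> (0 < cartan f a b) = (0 < f a b).
Proof.
move=> /root_nz/(dot_gt0 f) fb; rewrite /cartan pmulr_lgt0 ?invr_gt0 //.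
by rewrite pmulr_rgt0.
Qed.

(** Every root is obtained from a simple root by simple reflections: a positive
root that is not simple pairs positively with some simple root, whose
reflection lowers its height. The opposite root is carried along, starting
from s_b b = - b. *)
Lemma simple_root_ind (P : V -> Prop) :
  {in Delta, forall b, P b} ->
  {in Phi & Delta, forall a b, P a -> P (s b a)} ->
  {in Phi, forall a, P a}.
Proof.
move=> Pb Ps.
have pos n a : a \in Phi -> 0 < height a -> height a <= n%:R -> P a /\ P (- a).
  elim: n a => [|n IHn] a Ha ha hn; first by move: ha; rewrite ltNge hn.
  have [Hs|ns] := boolP (a \in Delta).
    split; first exact: Pb.
    rewrite -(refl_simpl f (root_nz Ha)); apply: Ps => //; exact: Pb.
  have [c ec] := pos_expand Ha ha.
  have [|b Hb [_ pb]] := scalar_simple_gt0 (F := pairing a) ec.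
    by rewrite /= /pairing cartan_diag // ltr0n.
  have Hb' := simple_root Hb.
  have cab : 0 < cartan f a b by rewrite cartan_gt0 // dotC -(cartan_gt0 b Ha).
  have [m em] := cartan_int Ha Hb'.
  have m1 : 1 <= m%:~R :> R by rewrite ler1z; move: cab; rewrite em ltr0z.
  have Hsa : s b a \in Phi by apply: (root_refl Phi_root).
  have nab : a <> b by move=> e; rewrite e Hb in ns.
  have [||P1 P2] := IHn (s b a) Hsa; first exact: pos_refl.
    by rewrite refl_linE (height_simple Hb) em; move: hn; rewrite -natr1; lra.
  split; first by rewrite -[a](reflK f b); apply: Ps.
  rewrite -[a](reflK f b) -linearN; apply: Ps => //; exact: rootN.
move=> a Ha; have [ha|ha] := heightP Ha.
  by have [n /(pos _ _ Ha ha)[]] := height_bound Ha.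
have ha' : 0 < height (- a) by rewrite linearN oppr_gt0.
have [n /(pos _ _ (rootN Ha) ha')[_]] := height_bound (rootN Ha).
by rewrite opprK.
Qed.

(** * Length and the strong Bruhat order *)

Lemma refl_prod_cat (r t : seq V) :
  refl_prod f (r ++ t) = (refl_prod f r \o refl_prod f t)%VF.
Proof.
by elim: r => [|a r IHr] /=; [rewrite comp_lfun1l | rewrite IHr comp_lfunA].
Qed.

Lemma refl_word a : a \in Phi ->
  exists2 r, {subset r <= Delta} & s a = refl_prod f r.
Proof.
move: a; apply: simple_root_ind => [b Hb|a b Ha Hb [r Hr er]].
  by exists [:: b]; [move=> x; rewrite inE => /eqP-> | rewrite /= comp_lfun1r].
exists (b :: rcons r b) => [x|].
  by rewrite inE mem_rcons inE => /or3P[/eqP->|/eqP->|/Hr].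
rewrite -cats1 /= refl_prod_cat -er /= comp_lfun1r; apply/lfunP => x.
by rewrite !comp_lfunE refl_refl.
Qed.

Lemma weyl_expr w : weyl f Phi w -> exists k, has_expr f Delta w k.
Proof.
move=> [r + ->]; elim: r => [|a r IHr] Hr; first by exists 0%N, [::].
have [x Hx|k [t [Ht _ et]]] := IHr; first by apply: Hr; rewrite inE Hx orbT.
have [q Hq eq] := refl_word (Hr a (mem_head _ _)).
exists (size (q ++ t)), (q ++ t); split=> // [x|].
  by rewrite mem_cat => /orP[/Hq|/Ht].
by rewrite refl_prod_cat /= eq et.
Qed.

Lemma len_min w k : has_expr f Delta w k -> (len f Delta w <= k)%N.
Proof.
move=> Hk; rewrite /len; case: pselect => [ex|[]]; last first.
  by exists k; apply/asboolP.
by case: ex_minnP => m _; apply; apply/asboolP.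
Qed.

Lemma len_expr w : weyl f Phi w -> has_expr f Delta w (len f Delta w).
Proof.
move=> /weyl_expr[k Hk]; rewrite /len; case: pselect => [ex|[]]; last first.
  by exists k; apply/asboolP.
by case: ex_minnP => m /asboolP.
Qed.

Lemma weyl_ker w : weyl f Phi w -> lker w == 0%VS.
Proof.
move=> [r _ ->]; apply/lker0P; elim: r => [|a r IHr] x y /=.
  by rewrite !id_lfunE.
by rewrite !comp_lfunE => /(can_inj (reflK f a))/IHr.
Qed.

Lemma weyl_refl a w : a \in Phi -> weyl f Phi w -> weyl f Phi (s a \o w)%VF.
Proof.
move=> Ha [r Hr ->]; exists (a :: r) => // x.
by rewrite inE => /predU1P[->|/Hr].
Qed.

Lemma inv_refl a w x : a \in Phi -> weyl f Phi w ->
  ((s a \o w)^-1)%VF x = (w^-1)%VF (s a x).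
Proof.
move=> Ha Hw; have Hsw := weyl_refl Ha Hw.
apply: (lker0P (weyl_ker Hsw)); rewrite lker0_lfunVK ?weyl_ker //.
by rewrite comp_lfunE lker0_lfunVK ?weyl_ker // reflK.
Qed.

Lemma inv_id x : (\1^-1)%VF x = x :> V.
Proof.
have H : lker (\1%VF : 'End(V)) == 0%VS.
  by apply/lker0P => y z; rewrite !id_lfunE.
by apply: (lker0P H); rewrite lker0_lfunVK // id_lfunE.
Qed.

Lemma inv_root w a : weyl f Phi w -> a \in Phi -> (w^-1)%VF a \in Phi.
Proof.
move=> [r + ->]; elim: r a => [|b r IHr] a Hr Ha /=; first by rewrite inv_id.
have Hb : b \in Phi by apply: Hr; rewrite inE eqxx.
have Hr' : {subset r <= Phi} by move=> x Hx; apply: Hr; rewrite inE Hx orbT.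
rewrite inv_refl //; last by exists r.
by apply: IHr => //; apply: (root_refl Phi_root).
Qed.

(** A simple reflection makes only its own root negative; so, if the inverse of
a word makes a positive root a negative, then at some letter a has become the
simple root of that letter, and s_a deletes the letter. *)
Lemma strong_exchange r a : {subset r <= Delta} -> a \in Phi -> 0 < height a ->
  height ((refl_prod f r)^-1%VF a) < 0 ->
  has_expr f Delta (s a \o refl_prod f r)%VF (size r).-1.
Proof.
elim: r a => [|b r IHr] a Hr Ha ha /=.
  by rewrite inv_id => /(lt_trans ha); rewrite ltxx.
have Hb : b \in Delta by apply: Hr; rewrite inE eqxx.
have Hr' : {subset r <= Delta} by move=> x Hx; apply: Hr; rewrite inE Hx orbT.
have Hb' := simple_root Hb.
have Wr : weyl f Phi (refl_prod f r) by exists r => // x /Hr' /simple_root.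
rewrite inv_refl // comp_lfunA => hb.
have [->|nab] := eqVneq a b.
  exists r; split=> //; apply/lfunP => x; by rewrite !comp_lfunE reflK.
have [|||t [Ht st et]] := IHr (s b a) Hr' => //.
- by apply: (root_refl Phi_root).
- by apply: pos_refl => //; apply/eqP.
case: r Hr Hr' Wr hb IHr st et => [|d r] Hr Hr' Wr hb IHr st et.
  by move: hb; rewrite /= inv_id => /lt_gtF; rewrite pos_refl //; apply/eqP.
exists (b :: t); split=> [x||].
- by rewrite inE => /predU1P[->|/Ht].
- by rewrite /= st.
rewrite [in RHS]/= -et; apply/lfunP => x.
by rewrite !comp_lfunE refl_refl !reflK.
Qed.

Local Notation ell := (len f Delta).

Lemma len_refl_lt w a : weyl f Phi w -> a \in Phi -> 0 < height a ->
  height ((w^-1)%VF a) < 0 -> (ell (s a \o w)%VF < ell w)%N.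
Proof.
move=> Hw Ha ha; have [r [Hr sr ew]] := len_expr Hw.
rewrite {1 2}ew => hw; have le := len_min (strong_exchange Hr Ha ha hw).
apply: (leq_ltn_trans le); rewrite sr prednK // lt0n -sr.
apply/negP => /nilP r0; move: hw; rewrite r0 /= inv_id => /(lt_trans ha).
by rewrite ltxx.
Qed.

Lemma len_refl_gt w a : weyl f Phi w -> a \in Phi -> 0 < height a ->
  (ell w < ell (s a \o w)%VF)%N = (0 < height ((w^-1)%VF a)).
Proof.
move=> Hw Ha ha; have [hw|hw] := heightP (inv_root Hw Ha); last first.
  by rewrite (lt_gtF hw) ltnNge ltnW // len_refl_lt.
rewrite hw.
have := @len_refl_lt (s a \o w)%VF a (weyl_refl Ha Hw) Ha ha.
rewrite inv_refl // refl_simpl ?root_nz // !linearN oppr_lt0 => /(_ hw).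
suff -> : (s a \o (s a \o w))%VF = w by [].
by apply/lfunP => x; rewrite !comp_lfunE reflK.
Qed.

Lemma len_simple w b : weyl f Phi w -> b \in Delta ->
  (ell (s b \o w)%VF <= (ell w).+1)%N.
Proof.
move=> /len_expr[r [Hr sr ew]] Hb; apply: len_min; exists (b :: r).
split; [move=> x | by rewrite /= sr | by rewrite /= -ew].
by rewrite inE => /predU1P[->|/Hr].
Qed.

Lemma bruhat_len u w : bruhat_le f Phi Delta u w -> u = w \/ (ell u < ell w)%N.
Proof.
elim=> [x y [a _ [_ lt]]|x|x y z _ IH1 _ IH2]; [by right | by left |].
case: IH1 => [->//|lt1]; case: IH2 => [<-|lt2]; first by right.
by right; apply: ltn_trans lt2.
Qed.

Lemma bruhat_first u w : bruhat_le f Phi Delta u w -> u <> w ->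
  exists2 a, a \in Phi & [/\ 0 < height a, (ell u < ell (s a \o u)%VF)%N &
    bruhat_le f Phi Delta (s a \o u)%VF w].
Proof.
move=> le; case: (clos_rt_rt1n _ _ _ _ le) => [//|x y [a Ha [-> lt]] le1 _].
have {}le1 := clos_rt1n_rt _ _ _ _ le1.
have [ha|ha] := heightP Ha; first by exists a.
by exists (- a); rewrite ?rootN // reflN linearN oppr_gt0.
Qed.

Lemma bruhat_cover u w : bruhat_le f Phi Delta u w -> ell w = (ell u).+1 ->
  exists2 a, a \in Phi & 0 < height a /\ w = (s a \o u)%VF.
Proof.
move=> le e; have [euw|a Ha [ha lt le']] := bruhat_first le.
  by move: e; rewrite euw => /n_Sn.
exists a => //; split=> //; have [->//|] := bruhat_len le'.
by rewrite e ltnS leqNgt lt.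
Qed.


(** The height after applying w^-1: its sign on a positive root a tells whether
s_a w is longer or shorter than w. *)
Definition height_at (w : 'End(V)) (x : V) : R := height ((w^-1)%VF x).

Fact height_at_is_scalar w : scalar (height_at w).
Proof. by move=> k x y; rewrite /height_at !linearP. Qed.

HB.instance Definition _ w :=
  GRing.isLinear.Build R V R *%R (height_at w) (height_at_is_scalar w).

Lemma height_atP w a : weyl f Phi w -> a \in Phi ->
  0 < height_at w a \/ height_at w a < 0.
Proof. by move=> Hw Ha; apply/heightP/inv_root. Qed.

Lemma height_at_refl w a x : weyl f Phi w -> a \in Phi ->
  height_at (s a \o w)%VF x = height_at w (s a x).
Proof. by move=> Hw Ha; rewrite /height_at inv_refl. Qed.

Lemma left_ascentP v b : weyl f Phi v -> b \in Delta ->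
  left_ascent f Phi Delta v b <-> 0 < height_at v b.
Proof.
move=> Hv Hb; have Hb' := simple_root Hb.
have hb : 0 < height b by rewrite height_simple.
rewrite /height_at -len_refl_gt //; split=> [[_ [/bruhat_len[]]]//|lt].
split=> //; split; first by apply: rt_step; exists b.
by move=> e; move: lt; rewrite -e ltnn.
Qed.

Lemma descent_lt w b : weyl f Phi w -> b \in Delta -> height_at w b < 0 ->
  bruhat_lt f Phi Delta (s b \o w)%VF w.
Proof.
move=> Hw Hb wb; have Hb' := simple_root Hb.
have hb : 0 < height b by rewrite height_simple.
have lt := len_refl_lt Hw Hb' hb wb.
split; last by move=> e; move: lt; rewrite e ltnn.
apply: rt_step; exists b => //; split=> //.
by apply/lfunP => x; rewrite !comp_lfunE reflK.
Qed.

(** * The pairing of roots in the simply laced case *)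

Section Laced.

Hypotheses (Phi_irr : irreducible f Phi) (Delta_laced : simply_laced f Delta).

Local Notation "''[' x , y ]" := (cartan f x y) : ring_scope.

Lemma simple_norm a b :
  a \in Delta -> b \in Delta -> f a b <> 0 -> f a a = f b b.
Proof.
move=> Ha Hb fab; have [->//|nab] := eqVneq a b.
have Ha' := simple_root Ha; have Hb' := simple_root Hb.
have fa := dot_gt0 f (root_nz Ha'); have fb := dot_gt0 f (root_nz Hb').
case: (Delta_laced Ha Hb nab) => [/eqP|e].
  rewrite mulf_eq0 /cartan !mulf_eq0 !invr_eq0 !(gt_eqF fa) !(gt_eqF fb).
  by rewrite (dotC f b a) !pnatr_eq0 /= !orbF orbb => /eqP.
have [m em] := cartan_int Ha' Hb'; have [n en] := cartan_int Hb' Ha'.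
have mn : m * n = 1 by apply/eqP; rewrite -(eqr_int R) rmorphM /= -em -en e.
have emn : m = n.
  have : (`|m| * `|n|)%N == 1%N by rewrite -abszM mn.
  rewrite muln_eq1 => /andP[/eqP m1 /eqP n1]; move: mn.
  by case: m m1 {em} => [] [|[]] // _; case: n n1 {en} => [] [|[]].
move: em; rewrite emn -en /cartan (dotC f b a).
move/(congr1 (fun t => t * f a a * f b b)).
have -> : 2 * f a b / f b b * f a a * f b b = (2 * f a b) * f a a.
  by field; rewrite gt_eqF.
have -> : 2 * f a b / f a a * f a a * f b b = (2 * f a b) * f b b.
  by field; rewrite gt_eqF.
by apply: mulfI; rewrite mulf_neq0 ?pnatr_eq0 //; apply/eqP.
Qed.

(** Roots are conjugate to simple roots, and simple roots of different norms are
orthogonal. Hence the roots of a given norm are orthogonal to all others,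
which irreducibility excludes unless there are no others. *)
Lemma root_norm a b : a \in Phi -> b \in Phi -> f a a = f b b.
Proof.
move=> Ha Hb; have [//|nab] := eqVneq (f a a) (f b b); exfalso.
pose A x := f x x == f a a.
have As c x : A (s c x) = A x by rewrite /A refl_isometry.
have orth_simple x : x \in Phi ->
    {in Delta, forall c, A x != A c -> f x c = 0}.
  move: x; apply: simple_root_ind => [c Hc d Hd ncd|x c Hx Hc IH d Hd].
    have [//|fcd] := eqVneq (f c d) 0.
    by move: ncd; rewrite /A (simple_norm Hc Hd) ?eqxx //; apply/eqP.
  rewrite As => nxd; rewrite reflE linearBl /= linearZl_LR /= IH // sub0r.
  have [exc|nxc] := eqVneq (A x) (A c); last first.
    by rewrite IH // mulr0 mul0r mul0r oppr0.
  have [->|fcd] := eqVneq (f c d) 0; first by rewrite mulr0 oppr0.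
  by move: nxd; rewrite exc /A (simple_norm Hc Hd) ?eqxx //; apply/eqP.
have [_ /(_ A)] := Phi_irr; apply; first by exists a => //; apply: eqxx.
  by exists b => //; rewrite /A eq_sym.
move=> x y Hx + Ax; move: y; apply: simple_root_ind => [d Hd Ad|y c Hy Hc IH].
  by apply: orth_simple => //; rewrite Ax (negbTE Ad).
rewrite As => Ay; rewrite reflE linearBr /= linearZr_LR /= IH // sub0r.
have [Ac|nAc] := boolP (A c).
  by rewrite (orth_simple y) ?(negbTE Ay) ?Ac // mulr0 mul0r mul0r oppr0.
by rewrite (orth_simple x) ?(negbTE nAc) ?Ax // mulr0 oppr0.
Qed.

Lemma cartanC a b : a \in Phi -> b \in Phi -> '[a, b] = '[b, a].
Proof. by move=> Ha Hb; rewrite /cartan dotC (root_norm Ha Hb). Qed.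

Lemma cartan_refl c x y : '[s c x, s c y] = '[x, y].
Proof. by rewrite /cartan !refl_isometry. Qed.

Lemma cartanDl x y z : '[x + y, z] = '[x, z] + '[y, z].
Proof. exact: (linearD (pairing z)). Qed.

Lemma cartanBl x y z : '[x - y, z] = '[x, z] - '[y, z].
Proof. exact: (linearB (pairing z)). Qed.

Lemma cartanZl k x z : '[k *: x, z] = k * '[x, z].
Proof. exact: (linearZ_LR (pairing z)). Qed.

Lemma cartan_lt2 a b : a \in Phi -> b \in Phi -> a <> b -> '[a, b] < 2.
Proof.
move=> Ha Hb /eqP; rewrite -subr_eq0 => /(dot_gt0 f).
have fb := dot_gt0 f (root_nz Hb).
rewrite !linearBl !linearBr /= (root_norm Ha Hb) (dotC f b a) => h.
by rewrite /cartan ltr_pdivrMr //; lra.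
Qed.

(** Cauchy-Schwarz for vectors of equal norm, and integrality. *)
Lemma root_pair a b : a \in Phi -> b \in Phi -> a <> b -> a <> - b ->
  [\/ '[a, b] = 1, '[a, b] = 0 | '[a, b] = -1].
Proof.
move=> Ha Hb n1 n2; have := cartan_lt2 Ha Hb n1.
have := cartan_lt2 Ha (rootN Hb) n2.
have -> : '[a, - b] = - '[a, b].
  by rewrite /cartan hnormN linearNr /= mulrN mulNr.
have [m ->] := cartan_int Ha Hb.
rewrite -mulrNz -[2]/(2%:~R : R) !ltr_int.
by case: m => [] [|[|m]] // _ _; [apply: Or32|apply: Or31|apply: Or33].
Qed.

Lemma rootB a b : a \in Phi -> b \in Phi -> '[a, b] = 1 -> a - b \in Phi.
Proof.
by move=> Ha Hb e; rewrite -(refl_sub e); apply: (root_refl Phi_root).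
Qed.

Lemma rootD a b : a \in Phi -> b \in Phi -> '[a, b] = -1 -> a + b \in Phi.
Proof.
by move=> Ha Hb e; rewrite -(refl_add e); apply: (root_refl Phi_root).
Qed.

(** Otherwise a - b would be a root with coefficients of both signs. *)
Lemma simple_cartan_le0 a b :
  a \in Delta -> b \in Delta -> a <> b -> '[a, b] <= 0.
Proof.
move=> Ha Hb nab; have Ha' := simple_root Ha; have Hb' := simple_root Hb.
have nab' : a <> - b.
  move=> e; have := height_simple Ha.
  by rewrite e linearN /= height_simple //; lra.
have [e|->|->] := root_pair Ha' Hb' nab nab'; [|by []|by rewrite oppr_le0].
have Hab := rootB Ha' Hb' e.
have ha : 0 < height (a - b).
  apply: (coef_gt0_pos Hab Ha); rewrite linearB /= !coef_simple // eqxx.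
  by rewrite eq_sym; move/eqP/negbTE: nab => ->; rewrite subr0.
have := coef_ge0 Hab ha Hb; rewrite linearB /= !coef_simple // eqxx.
by move/eqP/negbTE: nab => ->; rewrite sub0r oppr_ge0 ler10.
Qed.

(** * Roots graded by the coefficient of a simple root *)

Lemma coef_refl b a x : a \in Delta -> a <> b -> coef b (s a x) = coef b x.
Proof.
move=> Ha /eqP/negbTE nab.
by rewrite refl_linE (coef_simple b Ha) nab mulr0 subr0.
Qed.

(** A positive root of level 0 is a sum of simple roots other than b. *)
Lemma coef0_neg (H : {scalar V}) b k : b \in Delta ->
  (forall a, a \in Delta -> a <> b -> H a < 0) -> H k != 0 ->
  k \in Phi -> 0 < height k -> coef b k = 0 -> H k < 0.
Proof.
move=> Hb Hneg Hk0 Hk hk ck; rewrite lt_neqAle Hk0 leNgt; apply/negP => Hkpos.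
have [c ec] := pos_expand Hk hk.
have [a Ha [ca Haa]] := scalar_simple_gt0 ec Hkpos.
have [eab|nab] := eqVneq a b; last first.
  by have := Hneg a Ha (elimN eqP nab); rewrite ltNge ltW.
by move/eqP: ck; rewrite ec coef_sum // -eab pnatr_eq0 -leqn0 leqNgt ca.
Qed.

(** The height of the difference x - y decreases by 1 under a simple reflection
s_a with (x, a) - (y, a) = 1, which preserves the level; when that difference
is 2 instead, k = a works. Some a with positive difference occurs in x - y
because x - y has positive norm. *)
Lemma level_one_link b (c : V -> nat) x y : b \in Delta ->
  x \in Phi -> y \in Phi -> coef b x = 1 -> coef b y = 1 -> '[x, y] <= 0 ->
  x - y = \sum_(a <- Delta) a *+ c a ->
  exists2 k, k \in Phi & [/\ coef b k = 0, '[y, k] = -1 & '[x, k] = 1].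
Proof.
move=> Hb; have [n] := ubnP (\sum_(a <- Delta) c a)%N.
elim: n c x y => // n IHn c x y cn Hx Hy cx cy xy ec.
have [|a Ha [ca Fa]] := scalar_simple_gt0 (F := pairing x \- pairing y) ec.
  by rewrite /= /pairing !cartanBl (cartanC Hy Hx) !cartan_diag //; lra.
have Ha' := simple_root Ha.
have nab : a <> b.
  move=> eab; have := coef_sum c Ha; rewrite -ec linearB /= eab cx cy subrr.
  by rewrite -eab => /esym/eqP; rewrite pnatr_eq0 -leqn0 leqNgt ca.
have ca0 : coef b a = 0 by rewrite coef_simple //; move/eqP/negbTE: nab => ->.
have off z : coef b z = 1 -> a <> z /\ a <> - z.
  by move=> cz; split=> e; move: ca0; rewrite e ?linearN /= cz; lra.
have [ax1 ax2] := off x cx; have [ay1 ay2] := off y cy.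
have := root_pair Ha' Hx ax1 ax2; have := root_pair Ha' Hy ay1 ay2.
move: Fa; rewrite /= /pairing => Fa py px.
have [axy|/eqP naxy] := eqVneq ('[a, x] - '[a, y]) 1; last first.
  exists a => //; rewrite (cartanC Hx) // (cartanC Hy) //.
  split=> //; case: px => px; case: py => py;
    by rewrite ?px ?py in Fa naxy *; lra.
have es : s a x - s a y = \sum_(d <- Delta) d *+ (c d - (d == a)).
  transitivity (s a (x - y)); first by rewrite linearB.
  rewrite reflE -/(cartan f (x - y) a) cartanBl (cartanC Hx) //.
  rewrite (cartanC Hy) // axy scale1r ec.
  rewrite (bigD1_seq a) ?free_uniq ?simple_free //=.
  rewrite [in RHS](bigD1_seq a) ?free_uniq ?simple_free //=.
  rewrite eqxx mulrnBr // addrAC; congr (_ + _); apply: eq_bigr => d /negbTE->.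
  by rewrite subn0.
have [||||||k Hk [ck yk xk]] := IHn _ (s a x) (s a y) _ _ _ _ _ _ es.
- move: cn; rewrite (bigD1_seq a) ?free_uniq ?simple_free //=.
  rewrite [in X in _ -> X](bigD1_seq a) ?free_uniq ?simple_free //= eqxx.
  rewrite -(prednK ca) addSn !ltnS subn1 /=.
  by under [in X in _ -> X]eq_bigr => d /negbTE nd do rewrite nd subn0.
- exact: (root_refl Phi_root).
- exact: (root_refl Phi_root).
- by rewrite coef_refl.
- by rewrite coef_refl.
- by rewrite cartan_refl.
exists (s a k); first exact: (root_refl Phi_root).
by rewrite coef_refl // -(cartan_refl a y) -(cartan_refl a x) reflK.
Qed.

(** By induction on the height: a simple reflection s_a with a different from b
that lowers the height preserves the level; and if b itself pairs positively
with y, then b is the required root. *)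
Lemma level_one_split b y : b \in Delta -> y \in Phi -> 1 < coef b y ->
  exists2 x, x \in Phi & coef b x = 1 /\ '[x, y] = 1.
Proof.
move=> Hb Hy; have [n hn] := height_bound Hy.
elim: n y Hy hn => [|n IHn] y Hy hn cy.
  have := coef_gt0_pos Hy Hb (lt_trans ltr01 cy).
  by move=> /lt_le_trans/(_ hn); rewrite ltxx.
have [c ec] := pos_expand Hy (coef_gt0_pos Hy Hb (lt_trans ltr01 cy)).
have [|a Ha [ca ay]] := scalar_simple_gt0 (F := pairing y) ec.
  by rewrite /= /pairing cartan_diag // ltr0n.
have Ha' := simple_root Ha.
have cab : 0 <= coef b a <= 1.
  by rewrite coef_simple //; case: eqP => _; rewrite lexx ler01.
have nay : a <> y by move=> e; move: cab cy; rewrite e; lra.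
have nay' : a <> - y by move=> e; move: cab cy; rewrite e linearN /=; lra.
have ay1 : '[a, y] = 1.
  move: ay; rewrite /= /pairing.
  by case: (root_pair Ha' Hy nay nay') => [->//|->|->]; lra.
have [eab|/eqP nab] := eqVneq a b.
  by exists a => //; rewrite ay1 -eab coef_simple // eqxx.
have [|||x Hx [cx xy]] := IHn (s a y).
- exact: (root_refl Phi_root).
- rewrite refl_linE (height_simple Ha) (cartanC Hy) // ay1; move: hn.
  by rewrite -natr1; lra.
- by rewrite coef_refl.
exists (s a x); first exact: (root_refl Phi_root).
by rewrite coef_refl // -(cartan_refl a) reflK.
Qed.

(** The root b + k has coefficient 1 at b, hence is positive; a negative k would
give it a negative coefficient elsewhere. *)
Lemma level_zero_pos b k : b \in Delta -> k \in Phi -> coef b k = 0 ->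
  '[b, k] = -1 -> 0 < height k.
Proof.
move=> Hb Hk ck bk; have Hb' := simple_root Hb.
have Hbk := rootD Hb' Hk bk.
have hbk : 0 < height (b + k).
  apply: (coef_gt0_pos Hbk Hb).
  by rewrite linearD /= coef_simple // eqxx ck addr0.
case: (heightP Hk) => // hk.
have hNk : 0 < height (- k) by rewrite linearN oppr_gt0.
have [c ec] := pos_expand (rootN Hk) hNk.
have [a Ha [ca _]] := scalar_simple_gt0 ec hNk.
have cak : coef a k = - (c a)%:R.
  by rewrite -[k]opprK ec linearN /= coef_sum.
have nab : b <> a.
  move=> eab; move/eqP: ck; rewrite eab cak oppr_eq0 pnatr_eq0.
  by rewrite -leqn0 leqNgt ca.
have := coef_ge0 Hbk hbk Ha; rewrite linearD /= cak coef_simple //.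
move/eqP/negbTE: nab => ->; rewrite add0r oppr_ge0 lern0 => /eqP c0.
by rewrite c0 in ca.
Qed.

(** Subtracting such a root k from x increases (b, x) by 1 and stays at level 1;
hence at most three steps lead from any x down to b. *)
Lemma level_one_ind (P : V -> Prop) b : b \in Delta -> P b ->
  (forall y k, k \in Phi -> coef b k = 0 -> '[b, k] = -1 -> P y -> P (y + k)) ->
  forall x, x \in Phi -> coef b x = 1 -> P x.
Proof.
move=> Hb Pb step; have Hb' := simple_root Hb.
have cbb : coef b b = 1 by rewrite coef_simple // eqxx.
have down y : y \in Phi -> coef b y = 1 -> '[b, y] <= 0 ->
    (forall z, z \in Phi -> coef b z = 1 -> '[b, z] = '[b, y] + 1 -> P z) ->
    P y.
  move=> Hy cy yb IH; have hy : 0 < height y.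
    by apply: (coef_gt0_pos Hy Hb); rewrite cy ltr01.
  have [c ec] := pos_expand Hy hy.
  have cb : c b = 1%N by apply/eqP; rewrite -(eqr_nat R) -coef_sum // -ec cy.
  have eyb : y - b = \sum_(a <- Delta) a *+ (c a - (a == b)).
    rewrite {1}ec (bigD1_seq b) ?free_uniq ?simple_free //=.
    rewrite [in RHS](bigD1_seq b) ?free_uniq ?simple_free //= eqxx cb.
    rewrite addrAC subrr; congr (_ + _); apply: eq_bigr => a /negbTE->.
    by rewrite subn0.
  have yb' : '[y, b] <= 0 by rewrite (cartanC Hy Hb').
  have [k Hk [ck bk yk]] := level_one_link Hb Hy Hb' cy cbb yb' eyb.
  have Hyk := rootB Hy Hk yk.
  rewrite -(subrK k y); apply: step => //; apply: IH => //.
    by rewrite linearB /= cy ck subr0.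
  rewrite (cartanC Hb' Hyk) cartanBl (cartanC Hk Hb') bk.
  by rewrite (cartanC Hy Hb') opprK.
have P1 y : y \in Phi -> coef b y = 1 -> '[b, y] = 1 -> P y.
  move=> Hy cy e; have e' : '[y, b] = 1 by rewrite cartanC.
  have Hyb := rootB Hy Hb' e'.
  rewrite -(subrK b y) addrC; apply: step => //.
    by rewrite linearB /= cy cbb subrr.
  by rewrite (cartanC Hb' Hyb) cartanBl e' cartan_diag //; lra.
have P0 y : y \in Phi -> coef b y = 1 -> '[b, y] = 0 -> P y.
  move=> Hy cy e; apply: down => //; first by rewrite e.
  by move=> z Hz cz; rewrite e add0r; apply: P1.
move=> x Hx cx; have [<-//|/eqP nbx] := eqVneq b x.
have nbx' : b <> - x.
  by move=> e; have := cx; rewrite -[x]opprK -e linearN /= cbb; lra.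
have [e|e|e] := root_pair Hb' Hx nbx nbx'; [exact: P1|exact: P0|].
apply: down => //; first by rewrite e; lra.
by move=> z Hz cz; rewrite e addNr; apply: P0.
Qed.

(** A root y of level above 1 is x + (y - x), with x of level 1 and y - x a root
one level below y, by [level_one_split]. *)
Lemma level_ind (P : V -> Prop) b : b \in Delta ->
  (forall x, x \in Phi -> coef b x = 1 -> P x) ->
  (forall x y, P x -> P y -> P (x + y)) ->
  forall y, y \in Phi -> 0 < coef b y -> P y.
Proof.
move=> Hb P1 PD.
have PS n y : y \in Phi -> coef b y = n.+1%:R -> P y.
  elim: n y => [|n IHn] y Hy cy; first exact: P1.
  have [|x Hx [cx xy]] := level_one_split Hb Hy.
    by rewrite cy -[1]/(1%:R) ltr_nat.
  have yx : '[y, x] = 1 by rewrite cartanC.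
  rewrite -(subrK x y); apply: PD; last exact: P1.
  by apply: IHn (rootB Hy Hx yx) _; rewrite linearB /= cy cx -natr1 addrK.
move=> y Hy cy; have [c ec] := pos_expand Hy (coef_gt0_pos Hy Hb cy).
apply: (PS (c b).-1) => //; rewrite prednK ?[in LHS]ec ?coef_sum //.
by move: cy; rewrite ec coef_sum // ltr0n.
Qed.

(** The form L below is negative on the roots k of level 0 with (b, k) = -1 and
vanishes at b, so the two induction principles make it nonpositive at g,
whereas L g = 2 * H b + H g. *)
Lemma level_contradiction (b g : V) (H : {scalar V}) :
  b \in Delta -> g \in Phi -> 0 < H b -> 0 < H g -> 0 < coef b g ->
  '[b, g] = -1 ->
  (forall k, k \in Phi -> 0 < height k -> coef b k = 0 -> H k < 0) ->
  (forall k, k \in Phi -> 0 < height k -> coef b k = 0 ->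
     '[b, k] = -1 -> '[g, k] = 1 -> H (b + k) < 0) ->
  False.
Proof.
move=> Hb Hg Hb0 Hg0 cg bg Hneg Hsum.
(* The weight H b makes L vanish at b, since (b, g) = -1. *)
pose L x := H b * '[x, g] + H x.
have LD x y : L (x + y) = L x + L y.
  by rewrite /L cartanDl linearD /=; ring.
have Lb : L b = 0 by rewrite /L bg; ring.
have Lk k : k \in Phi -> coef b k = 0 -> '[b, k] = -1 -> L k < 0.
  move=> Hk ck bk; have hk := level_zero_pos Hb Hk ck bk.
  have Hk0 := Hneg k Hk hk ck.
  have kg1 : k <> g by move=> e; move: cg; rewrite -e ck ltxx.
  have kg2 : k <> - g.
    by move=> e; move: cg; rewrite -[g]opprK -e linearN /= ck oppr0 ltxx.
  have [e|e|e] := root_pair Hk Hg kg1 kg2; rewrite /L e; [|lra|lra].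
  have := Hsum k Hk hk ck bk; rewrite (cartanC Hg) // => /(_ e).
  by rewrite linearD /=; lra.
suff : L g <= 0 by rewrite /L cartan_diag //; lra.
apply: (level_ind (P := fun x => L x <= 0) Hb) Hg cg.
  apply: (level_one_ind (P := fun x => L x <= 0) Hb); first by rewrite Lb.
  by move=> y k Hk ck /(Lk k Hk ck) Lk0 Ly; rewrite LD; lra.
by move=> x y Lx Ly; rewrite LD; lra.
Qed.

(** * Ascents of the lower element *)

(** Here s_(x + y) = s_x s_y s_x, and each of the three factors increases the
length, because u^-1 makes x, x + y and y positive. *)
Lemma len_refl_add u x y : weyl f Phi u -> x \in Phi -> y \in Phi ->
  0 < height x -> 0 < height y -> '[x, y] = -1 ->
  0 < height_at u x -> 0 < height_at u y ->
  (ell u + 3 <= ell (s (x + y) \o u)%VF)%N.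
Proof.
move=> Hu Hx Hy hx hy xy ux uy.
have yx : '[y, x] = -1 by rewrite cartanC.
have sxy : s x y = x + y by rewrite (refl_add yx) addrC.
have syx := refl_add xy.
have Hu1 := weyl_refl Hx Hu; have Hu2 := weyl_refl Hy Hu1.
have e1 : (ell u < ell (s x \o u)%VF)%N by rewrite len_refl_gt.
have e2 : (ell (s x \o u)%VF < ell (s y \o (s x \o u))%VF)%N.
  rewrite len_refl_gt // -/(height_at _ _) height_at_refl // sxy.
  by rewrite linearD addr_gt0.
have e3 : (ell (s y \o (s x \o u))%VF < ell (s x \o (s y \o (s x \o u)))%VF)%N.
  rewrite len_refl_gt // -/(height_at _ _) height_at_refl // height_at_refl //.
  by rewrite syx -sxy reflK.
have -> : (s (x + y) \o u = s x \o (s y \o (s x \o u)))%VF.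
  by apply/lfunP => z; rewrite -sxy !comp_lfunE refl_refl.
rewrite addn3; apply: leq_ltn_trans e3; exact: leq_ltn_trans e2.
Qed.

(** If H (b + k) were positive, [len_refl_add] would apply to s_b v and to the
decomposition g = (g - k) + k, because b and g - k are orthogonal and s_b maps
k to b + k; but s_g lengthens s_b v by only 1. *)
Lemma cover_sum_neg v b g k : weyl f Phi v -> b \in Delta -> g \in Phi ->
  k \in Phi -> 0 < height_at v b -> 0 < height_at v g -> 0 < coef b g ->
  '[b, g] = -1 -> ell (s g \o (s b \o v))%VF = (ell v).+2 ->
  0 < height k -> coef b k = 0 -> height_at v k < 0 ->
  '[b, k] = -1 -> '[g, k] = 1 -> height_at v (b + k) < 0.
Proof.
move=> Hv Hb Hg Hk vb vg cg bg len2 hk ck vk bk gk.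
have Hb' := simple_root Hb; have Hbk := rootD Hb' Hk bk.
have hb : 0 < height b by rewrite height_simple.
have [vbk|//] := height_atP Hv Hbk.
have Hx := rootB Hg Hk gk; set x := g - k in Hx.
have hx : 0 < height x.
  by apply: (coef_gt0_pos Hx Hb); rewrite linearB /= ck subr0.
have xb : '[x, b] = 0.
  by rewrite cartanBl (cartanC Hg Hb') (cartanC Hk Hb') bg bk subrr.
have kb : '[k, b] = -1 by rewrite cartanC.
have ub : (ell v < ell (s b \o v)%VF)%N by rewrite len_refl_gt.
have : (ell (s b \o v)%VF + 3 <= ell (s (x + k) \o (s b \o v))%VF)%N.
  apply: len_refl_add => //; first exact: weyl_refl.
  - by rewrite cartanBl gk cartan_diag //; lra.
  - rewrite height_at_refl // (refl_fix xb) linearB /= subr_gt0.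
    exact: lt_trans vg.
  - by rewrite height_at_refl // (refl_add kb) addrC.
by rewrite subrK len2 addn3 !ltnS ltnNge (ltnW ub).
Qed.

(** Here w^-1 b = v^-1 s_b s_g b. If (b, g) = 0 then s_b s_g b = - b, so w^-1 b
is negative. If (b, g) = 1 then s_b s_g b = - g, and w^-1 b is again negative,
because v^-1 makes b and s_b g = g - b positive. If (b, g) = -1 then
s_b s_g b = g. *)
Lemma ascent_not_descent v w b : weyl f Phi v -> b \in Delta ->
  0 < height_at v b -> ell w = (ell v).+2 ->
  bruhat_le f Phi Delta (s b \o v)%VF w -> ~ height_at w b < 0 ->
  exists2 g, g \in Phi & [/\ 0 < height g, w = (s g \o (s b \o v))%VF,
    '[b, g] = -1 & 0 < height_at v g].
Proof.
move=> Hv Hb vb lw le wb; have Hb' := simple_root Hb.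
have hb : 0 < height b by rewrite height_simple.
have lu : ell (s b \o v)%VF = (ell v).+1.
  by apply/eqP; rewrite eqn_leq len_simple // len_refl_gt.
have [|g Hg [hg ew]] := bruhat_cover le; first by rewrite lu.
have Hu := weyl_refl Hb' Hv.
have ug : 0 < height_at v (s b g).
  rewrite -height_at_refl // /height_at -len_refl_gt // -ew lw lu; exact: ltnSn.
have wbE : height_at w b = height_at v (s b (s g b)).
  by rewrite ew !height_at_refl.
have nbg : b <> g.
  move=> e; move: ug; rewrite -e refl_simpl ?root_nz // linearN /=; lra.
have nbg' : b <> - g by move=> e; move: hb; rewrite e linearN /=; lra.
exists g => //; have [e|e|e] := root_pair Hb' Hg nbg nbg'.
- have e' : '[g, b] = 1 by rewrite cartanC.
  move: wb ug; rewrite wbE (refl_sub e) (refl_sub e') linearB /= (refl_sub e').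
  rewrite refl_simpl ?root_nz // !linearB linearN /=; lra.
- have e' : '[g, b] = 0 by rewrite cartanC.
  move: wb; rewrite wbE (refl_fix e) refl_simpl ?root_nz // linearN /=; lra.
- have e' : '[g, b] = -1 by rewrite cartanC.
  split=> //; move: wb; rewrite wbE (refl_add e) linearD /= (refl_add e').
  rewrite refl_simpl ?root_nz // addrCA addNr addr0 => /negP.
  rewrite -leNgt le_eqVlt => /orP[/eqP|//].
  by have [|] := height_atP Hv Hg; lra.
Qed.

(** The rotation s_d s_a moves d - a by 3 a, while s_g s_b moves every vector
within the span of b and g, so a lies in that span. Solving for its
coordinates from (a, b) and (a, g) leaves a = g, or a = - b - g, which is not
positive. *)
Lemma coplanar_simple a b d g : a \in Delta -> b \in Delta -> a <> b ->
  d \in Phi -> g \in Phi -> 0 < height g -> '[a, d] = -1 -> '[b, g] = -1 ->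
  (forall x, s d (s a x) = s g (s b x)) -> a = g.
Proof.
move=> Ha Hb nab Hd Hg hg ad bg E; apply: contrapT => nag.
have Ha' := simple_root Ha; have Hb' := simple_root Hb.
have ha := height_simple Ha; have hb := height_simple Hb.
have da : '[d, a] = -1 by rewrite cartanC.
have gb : '[g, b] = -1 by rewrite cartanC.
have D x : s g (s b x) - x = - '[x, b] *: b + - ('[x, g] + '[x, b]) *: g.
  rewrite !refl_cartan cartanBl cartanZl bg mulrN1 opprK addrAC (addrAC x).
  by rewrite subrr add0r !scaleNr.
have [m [n e3]] : exists m n, 3 *: a = m *: b + n *: g.
  exists (- '[d - a, b]), (- ('[d - a, g] + '[d - a, b])); rewrite -D.
  have -> : s g (s b (d - a)) = a + (a + d).
    rewrite -E [s a _]linearB /= (refl_add da) refl_simpl ?root_nz // opprK.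
    rewrite !raddfD /= (refl_add ad) (refl_simpl f (root_nz Hd)).
    by rewrite [a + d]addrC addKr.
  by rewrite opprB -addrA addrACA subrr addr0 scaler_nat mulrS mulr2n.
have P z : 3 * '[a, z] = m * '[b, z] + n * '[g, z].
  by rewrite -!cartanZl -cartanDl e3.
have nag' : a <> - g by move=> e; move: ha; rewrite e linearN /=; lra.
have nab' : a <> - b by move=> e; move: ha; rewrite e linearN /= hb; lra.
have ab0 := simple_cartan_le0 Ha Hb nab.
have Pb := P b; have Pg := P g; have Pa := P a; move: Pa Pb Pg.
rewrite (cartanC Hb' Ha') (cartanC Hg Ha') gb bg !cartan_diag //.
have [ab|ab|ab] := root_pair Ha' Hb' nab nab'; rewrite ab in ab0 *; first lra;
  have [ag|ag|ag] := root_pair Ha' Hg nag nag'; rewrite ag => Pa Pb Pg;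
  clear nab nag nag' nab' E D P; try lra.
have [em en] : m = -3 /\ n = -3 by split; lra.
have := congr1 height e3; rewrite em en linearD /= !scalarZ.
by rewrite ha hb; lra.
Qed.

End Laced.

End Base.

Theorem theoremA37 (R : realFieldType) (V : vectType R)
    (f : {dot V for idfun}) (Phi Delta : seq V)
    (Phi_root : root_system f Phi) (Phi_irr : irreducible f Phi)
    (Delta_base : base Phi Delta) (Delta_laced : simply_laced f Delta)
    (v w : 'End(V)) (Wv : weyl f Phi v) (Ww : weyl f Phi w)
    (len_vw : len_diff f Delta v w = 2)
    (le_vw : bruhat_le f Phi Delta v w)
    (asc_le : forall b : V, left_ascent f Phi Delta v b ->
       bruhat_le f Phi Delta (refl f b \o v)%VF w) :
  exists b : V, left_ascent f Phi Delta v b /\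
    bruhat_lt f Phi Delta (refl f b \o w)%VF w.
Proof.
have lw : len f Delta w = (len f Delta v).+2.
  by apply/eqP; move/eqP: len_vw; rewrite /len_diff subr_eq.
pose H : {scalar V} := height_at Delta v.
have HP x : x \in Phi -> 0 < H x \/ H x < 0.
  exact: (height_atP Phi_root Delta_base Wv).
apply: contrapT => none.
have asc b : b \in Delta -> 0 < H b ->
    bruhat_le f Phi Delta (refl f b \o v)%VF w.
  by move=> Hb vb; apply: asc_le; apply/left_ascentP.
have nodesc b : b \in Delta -> 0 < H b -> ~ height_at Delta w b < 0.
  move=> Hb vb wb; apply: none; exists b; split; first exact/left_ascentP.
  exact: descent_lt.
have nvw : v <> w.
  by move=> e; move: lw; rewrite e; elim: (len f Delta w) => // n IHn [].
have [b Hb vb] : exists2 b, b \in Delta & 0 < H b.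
  have [a Ha [ha lt _]] := bruhat_first Phi_root Delta_base le_vw nvw.
  have va : 0 < H a.
    by rewrite /H /= /height_at -(len_refl_gt Phi_root Delta_base).
  have [c ec] := pos_expand Delta_base Ha ha.
  by have [b Hb [_ vb]] := scalar_simple_gt0 ec va; exists b.
have Hb' := simple_root Delta_base Hb.
have [g Hg [hg ew bg vg]] := ascent_not_descent Phi_root Delta_base Phi_irr
  Delta_laced Wv Hb vb lw (asc b Hb vb) (nodesc b Hb vb).
have gb : cartan f g b = -1 by rewrite (cartanC Phi_root Delta_base).
(* Another ascent a would equal g, which is a descent of w = s_g (s_b v). *)
have other a : a \in Delta -> a <> b -> H a < 0.
  move=> Ha nab; have Ha' := simple_root Delta_base Ha.
  case: (HP a Ha') => // va.
  have [d Hd [_ ew' ad _]] := ascent_not_descent Phi_root Delta_base Phi_irr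
    Delta_laced Wv Ha va lw (asc a Ha va) (nodesc a Ha va).
  have eag : a = g.
    apply: (coplanar_simple Phi_root Delta_base Phi_irr Delta_laced Ha Hb nab
      Hd) => // x.
    have := congr1 (fun t : 'End(V) => t (v^-1%VF x)) (etrans (esym ew') ew).
    by rewrite !comp_lfunE !lker0_lfunVK // (weyl_ker Wv).
  case: (nodesc a Ha va); rewrite eag ew.
  have Wu := weyl_refl Hb' Wv.
  rewrite (height_at_refl Delta _ Wu Hg) (height_at_refl Delta _ Wv Hb').
  rewrite (refl_simpl f (root_nz Phi_root Hg)) linearN /= (refl_add gb).
  by rewrite linearN linearD /= oppr_lt0 addr_gt0.
have Hneg k : k \in Phi -> 0 < height Delta k -> coef Delta b k = 0 -> H k < 0.
  move=> Hk hk ck; apply: (coef0_neg Delta_base (H := H) Hb other) => //.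
  by case: (HP k Hk) => [/gt_eqF|/lt_eqF] ->.
have cg : 0 < coef Delta b g.
  rewrite lt_neqAle (coef_ge0 Delta_base Hg hg Hb) andbT eq_sym.
  by apply/eqP => /(Hneg g Hg hg) /(lt_trans vg); rewrite ltxx.
apply: (level_contradiction Phi_root Delta_base Phi_irr Delta_laced Hb Hg vb vg
  cg bg Hneg) => k Hk hk ck bk gk.
apply: (cover_sum_neg Phi_root Delta_base Phi_irr Delta_laced Wv Hb Hg Hk vb vg
  cg bg) => //.
- by rewrite -ew.
- exact: Hneg.
Qed.
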